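(* Let $R$ be a ring and $I$ an ideal of $R$. Consider the following conditions: (1) Every left $R$-module is $I$-supplemented. (2) Every projective left $R$-module is $I$-supplemented. (3) Every projective left $R$-module is $I$-lifting. (4) Every free left $R$-module is $I$-lifting. (5) Every free left $R$-module is $I$-supplemented. (6) $R$ is left $I$-perfect. Then $(1)\Rightarrow(2)\Rightarrow(5)\Rightarrow(6)$ and $(3)\Rightarrow(4)\Rightarrow(5)$. If moreover $R$ is a strongly left PSD ring for $I$, then also $(2)\Rightarrow(3)$ and $(6)\Rightarrow(1)$.
   Context: Rings are associative with identity; modules are unital left modules; $I$ is a two-sided ideal of $R$. A submodule $N\le M$ is PSD in $M$ if for every submodule $X\le M$ with $N+X=M$ there is a projective direct summand $S$ of $M$ (depending on $X$) with $S\le N$ and $M=S\oplus X$. $M$ is PSD for $I$ if every submodule of $IM$ is PSD in $M$. $R$ is a strongly left PSD ring for $I$ if every projective left $R$-module is PSD for $I$. $M$ is $I$-supplemented if for every submodule $X\le M$ there is a submodule $Y\le M$ with $X+Y=M$, $X\cap Y\subseteq IY$ and $X\cap Y$ PSD in $Y$. $M$ is $I$-lifting if for every submodule $X\le M$ there is a decomposition $M=A\oplus B$ with $A\subseteq X$, $X\cap B\subseteq IB$ and $X\cap B$ PSD in $B$. $R$ is left $I$-perfect if every submodule $X$ of any projective left $R$-module $P$ has a decomposition $X=A\oplus B$ where $A$ is a direct summand of $P$ and $B\subseteq IP$. *)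

(* Defs.v *)
From HB Require Import structures.
From mathcomp Require Import all_boot all_algebra.
From mathcomp Require Import boolp classical_sets.

Set Implicit Arguments.
Unset Strict Implicit.
Unset Printing Implicit Defensive.

Import GRing.Theory.
Local Open Scope ring_scope.
Local Open Scope classical_set_scope.

(* Submodules of M are the library's [submodClosed M], i.e. boolean predicates
   closed under 0, +, and scaling; by [boolp] every Prop-valued submodule is of
   this form.  [pzRingType] allows the zero ring. *)

Section SubmoduleAsModule.
Variables (R : pzRingType) (M : lmodType R) (N : submodClosed M).

Record submod := Submod { submod_val : M; _ : submod_val \in N }.

HB.instance Definition _ := [isSub for submod_val].
HB.instance Definition _ := [Choice of submod by <:].
HB.instance Definition _ := [SubChoice_isSubLmodule of submod by <:].

End SubmoduleAsModule.

Definition two_sided (R : pzRingType) (I : zmodClosed R) : Prop :=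
  forall r x : R, x \in I -> r * x \in I /\ x * r \in I.

Definition projective (R : pzRingType) (P : lmodType R) : Prop :=
  forall (M N : lmodType R) (g : {linear M -> N}) (f : {linear P -> N}),
    (forall y, exists x, g x = y) ->
    exists h : {linear P -> M}, forall p, g (h p) = f p.

Section Modules.
Variables (R : pzRingType) (M : lmodType R).

(* Indexing a basis by itself is harmless: over a nonzero ring a linearly
   independent family is injective, and over the zero ring M = 0 has the empty
   basis. *)
Definition is_basis (E : set M) : Prop :=
  (forall (s : seq M) (c : M -> R), uniq s -> [set` s] `<=` E ->
     \sum_(e <- s) c e *: e = 0 -> forall e, e \in s -> c e = 0) /\
  (forall x : M, exists (s : seq M) (c : M -> R),
     [set` s] `<=` E /\ x = \sum_(e <- s) c e *: e).

Definition free_module : Prop := exists E : set M, is_basis E.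

Definition sum_set (A B : set M) : set M := [set a + b | a in A & b in B].

(* C is the internal direct sum of A and B. *)
Definition direct_sum (A B C : set M) : Prop :=
  sum_set A B = C /\ A `&` B = [set 0].

Definition direct_summand (A : submodClosed M) : Prop :=
  exists B : submodClosed M, direct_sum [set` A] [set` B] setT.

(* The product IN: finite sums of products, not just products. *)
Definition ideal_mul (I : zmodClosed R) (N : set M) : set M :=
  [set x | exists (n : nat) (a : 'I_n -> R) (y : 'I_n -> M),
     [/\ forall i, a i \in I, forall i, N (y i) &
         x = \sum_(i < n) a i *: y i]].

Definition PSD_in (N : set M) : Prop :=
  forall X : submodClosed M, sum_set N [set` X] = setT ->
  exists S : submodClosed M,
    [/\ projective (submod S), direct_summand S, [set` S] `<=` N &
        direct_sum [set` S] [set` X] setT].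

Definition PSD_for (I : zmodClosed R) : Prop :=
  forall N : submodClosed M, [set` N] `<=` ideal_mul I setT -> PSD_in [set` N].

End Modules.

Definition strongly_left_PSD (R : pzRingType) (I : zmodClosed R) : Prop :=
  forall P : lmodType R, projective P -> PSD_for P I.

(* The preimage of X under the inclusion of Y is the intersection of X and Y,
   seen as a submodule of the module Y. *)
Definition trace_on (R : pzRingType) (M : lmodType R) (X Y : submodClosed M) :
  set (submod Y) := [set y | \val y \in X].
Arguments trace_on {R M} X Y.

Definition supplemented (R : pzRingType) (I : zmodClosed R)
    (M : lmodType R) : Prop :=
  forall X : submodClosed M, exists Y : submodClosed M,
    [/\ sum_set [set` X] [set` Y] = setT,
        [set` X] `&` [set` Y] `<=` ideal_mul I [set` Y] &
        PSD_in (trace_on X Y)].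

Definition lifting (R : pzRingType) (I : zmodClosed R)
    (M : lmodType R) : Prop :=
  forall X : submodClosed M, exists A B : submodClosed M,
    [/\ direct_sum [set` A] [set` B] setT,
        [set` A] `<=` [set` X],
        [set` X] `&` [set` B] `<=` ideal_mul I [set` B] &
        PSD_in (trace_on X B)].

Definition left_perfect (R : pzRingType) (I : zmodClosed R) : Prop :=
  forall P : lmodType R, projective P ->
  forall X : submodClosed P, exists A B : submodClosed P,
    [/\ direct_sum [set` A] [set` B] [set` X],
        direct_summand A &
        [set` B] `<=` ideal_mul I setT].

(* Main.v *)
(* The core is a decomposition P = A + C (direct) with A <= X and X n C <= IC,
   for a submodule X of a supplemented projective module P.  Let Y be a
   supplement of X and W a supplement of Y.  Projectivity yields maps f and t
   from P to X and to W that are congruent to the identity modulo Y; put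
   g = f o t and h = 1 - g.  Splitting W by means of the PSD property gives
   S1 <= X n Y such that h is injective on V = g^-1(S1) and (X n Y) + h(V) = Y.
   Splitting Y = S2 + h(V) with S2 <= X n Y then gives P = h^-1(S2) + V, both
   sums being direct, and X <= h^-1(S2) + (X n Y).
   If R is strongly left PSD, then X n C is PSD in the projective module C,
   and PSD submodules are preserved by surjective images, which carries the
   decomposition of a free cover of M over to a supplement in M. *)

Require Import Defs.
From HB Require Import structures.
From mathcomp Require Import all_boot all_algebra.
From mathcomp Require Import boolp classical_sets functions.

Set Implicit Arguments.
Unset Strict Implicit.
Unset Printing Implicit Defensive.

Import GRing.Theory.
Local Open Scope ring_scope.
Local Open Scope classical_set_scope.

(** * Linear maps and submodules given by predicates *)

Lemma linear_of (R : pzRingType) (M N : lmodType R) (f : M -> N) :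
  linear f -> exists g : {linear M -> N}, g =1 f.
Proof.
move=> fP.
pose g : {linear M -> N} := HB.pack f (GRing.isLinear.Build R M N _ f fP).
by exists g.
Qed.

Lemma submod_of (R : pzRingType) (M : lmodType R) (P : M -> Prop) :
  P 0 -> (forall a x y, P x -> P y -> P (a *: x + y)) ->
  exists S : submodClosed M, forall x, x \in S <-> P x.
Proof.
move=> P0 PD; pose p x : bool := `[< P x >].
have cl : subsemimod_closed p.
  split; first split; first exact/asboolP.
    move=> x y /asboolP Px /asboolP Py; apply/asboolP.
    by rewrite -[x]scale1r; apply: PD.
  move=> a x /asboolP Px; apply/asboolP.
  by rewrite -[_ *: _]addr0; apply: PD.
pose S : submodClosed M :=
  HB.pack p (GRing.isSubSemiModClosed.Build R M p cl).
by exists S => x; split => [/asboolP //|Px]; apply/asboolP.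
Qed.

Lemma submodB (R : pzRingType) (M : lmodType R) (S : submodClosed M) x y :
  x \in S -> y \in S -> x - y \in S.
Proof. by move=> xS yS; rewrite -scaleN1r rpredD ?rpredZ. Qed.

(* Closure of G under linear combinations and triviality of its fibre over 0
   make G single-valued, so that the values chosen depend linearly on x. *)
Lemma linear_graph (R : pzRingType) (M N : lmodType R) (G : M -> N -> Prop) :
  (forall x, exists y, G x y) ->
  (forall a x y x' y', G x y -> G x' y' -> G (a *: x + x') (a *: y + y')) ->
  (forall y, G 0 y -> y = 0) ->
  exists f : {linear M -> N}, forall x, G x (f x).
Proof.
move=> /choice[f fG] GD G0.
have [|g gf] := @linear_of _ _ _ f; last by exists g => x; rewrite gf.
move=> a x y; apply/esym/eqP; rewrite -subr_eq0; apply/eqP/G0.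
have := GD (-1) _ _ _ _ (fG (a *: x + y)) (GD a _ _ _ _ (fG x) (fG y)).
by rewrite !scaleN1r addNr [- f _ + _]addrC.
Qed.

Lemma submod_corestrict (R : pzRingType) (M N : lmodType R)
    (Y : submodClosed N) (f : {linear M -> N}) :
  (forall x, f x \in Y) ->
  exists g : {linear M -> submod Y}, forall x, \val (g x) = f x.
Proof.
move=> fY; have [|g gE] := @linear_of _ _ _ (fun x => Submod (fY x)).
  by move=> a x y; apply: val_inj; rewrite /= linearP.
by exists g => x; rewrite gE.
Qed.

Lemma submod_inclusion (R : pzRingType) (M : lmodType R) (X : submodClosed M) :
  exists f : {linear submod X -> M}, forall x, f x = \val x.
Proof. by apply: (linear_of (f := fun x => \val x)) => a x y. Qed.

Lemma submod_preim (R : pzRingType) (M N : lmodType R) (f : {linear M -> N})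
    (X : submodClosed N) :
  exists S : submodClosed M, forall x, x \in S <-> f x \in X.
Proof.
apply: submod_of => [|a x y fx fy]; first by rewrite linear0 rpred0.
by rewrite linearP rpredD ?rpredZ.
Qed.

Lemma submod_image (R : pzRingType) (M N : lmodType R) (f : {linear M -> N})
    (X : submodClosed M) :
  exists S : submodClosed N, forall y, y \in S <-> exists2 x, x \in X & f x = y.
Proof.
apply: submod_of => [|a _ _ [x xX <-] [y yX <-]].
  by exists 0; rewrite ?rpred0 ?linear0.
by exists (a *: x + y); rewrite ?linearP // rpredD ?rpredZ.
Qed.

Lemma submod_cap (R : pzRingType) (M : lmodType R) (X Y : submodClosed M) :
  exists S : submodClosed M, forall x, x \in S <-> x \in X /\ x \in Y.
Proof.
apply: submod_of => [|a x y [? ?] [? ?]]; first by rewrite !rpred0.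
by rewrite !rpredD ?rpredZ.
Qed.

(** * Direct sums and their projections *)

Lemma sum_setTP (R : pzRingType) (M : lmodType R) (A B : set M) :
  sum_set A B = setT <->
  forall x, exists a b, [/\ A a, B b & x = a + b].
Proof.
split=> [AB x|AB].
  by have: setT x by []; rewrite -AB => -[a Aa [b Bb <-]]; exists a, b.
apply/seteqP; split=> // x _; have [a [b [Aa Bb ->]]] := AB x.
by exists a => //; exists b.
Qed.

Lemma direct_sumTP (R : pzRingType) (M : lmodType R) (A B : submodClosed M) :
  direct_sum [set` A] [set` B] setT <->
  (forall x, exists a b, [/\ a \in A, b \in B & x = a + b]) /\
  (forall x, x \in A -> x \in B -> x = 0).
Proof.
split=> [[/sum_setTP AB AB0]|[AB AB0]].
  split=> // x xA xB; suff: [set 0] x by [].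
  by rewrite -AB0.
split; first exact/sum_setTP.
apply/seteqP; split=> [x [xA xB]|x ->]; first exact: AB0.
by split; exact: rpred0.
Qed.

Lemma direct_sumC (R : pzRingType) (M : lmodType R) (A B : submodClosed M) :
  direct_sum [set` A] [set` B] setT -> direct_sum [set` B] [set` A] setT.
Proof.
move=> /direct_sumTP[AB AB0]; apply/direct_sumTP; split=> [x|x xB xA].
  by have [a [b [aA bB ->]]] := AB x; exists b, a; rewrite addrC.
exact: AB0.
Qed.

Lemma direct_sum_proj (R : pzRingType) (M : lmodType R)
    (A B : submodClosed M) : direct_sum [set` A] [set` B] setT ->
  exists p : {linear M -> M},
    [/\ forall x, p x \in A, forall x, x - p x \in B,
        forall x, x \in A -> p x = x & forall x, x \in B -> p x = 0].
Proof.
move=> /direct_sumTP[AB AB0].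
have [|||p pP] := @linear_graph _ M M (fun x a => a \in A /\ x - a \in B).
- move=> x; have [a [b [aA bB ->]]] := AB x; exists a.
  by rewrite addrC addKr.
- move=> a x y x' y' [yA yB] [yA' yB']; split; first by rewrite rpredD ?rpredZ.
  by rewrite opprD addrACA -scalerBr rpredD ?rpredZ.
- move=> y [yA]; rewrite sub0r => yB; apply: AB0 => //.
  by rewrite -[y]opprK -scaleN1r rpredZ.
have pA x := (pP x).1; have pB x := (pP x).2.
exists p; split=> // x xAB.
  apply/esym/eqP; rewrite -subr_eq0; apply/eqP/AB0 => //.
  exact: submodB.
apply: AB0 => //; rewrite -[p x](subKr x); exact: submodB.
Qed.

(** * Projective modules *)

Lemma projective_retract (R : pzRingType) (P Q : lmodType R)
    (i : {linear Q -> P}) (r : {linear P -> Q}) :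
  cancel i r -> projective P -> projective Q.
Proof.
move=> irK projP M N g f g_surj.
have [h hP] := projP M N g (f \o r) g_surj.
by exists (h \o i) => q /=; rewrite hP /= irK.
Qed.

Lemma projective_bijective (R : pzRingType) (P Q : lmodType R)
    (f : {linear P -> Q}) :
  (forall y, exists x, f x = y) -> (forall x, f x = 0 -> x = 0) ->
  projective P -> projective Q.
Proof.
move=> f_surj f_inj.
have [//||//|g gP] := @linear_graph _ Q P (fun y x => f x = y).
  by move=> a _ x _ x' <- <-; rewrite linearP.
exact: projective_retract gP.
Qed.

Lemma projective_summand (R : pzRingType) (P : lmodType R)
    (A B : submodClosed P) :
  direct_sum [set` A] [set` B] setT -> projective P -> projective (submod A).
Proof.
move=> /direct_sum_proj[p [pA _ pK _]].
have [i iE] := submod_inclusion A; have [r rE] := submod_corestrict pA.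
apply: (@projective_retract _ _ _ i r) => x.
by apply: val_inj; rewrite rE iE pK //; apply: valP.
Qed.

(** The addition map from [X * Y] to [P] is onto, so the identity of [P] lifts through it; [f] is
    the [X]-component of the lift. *)
Lemma projective_split (R : pzRingType) (P : lmodType R)
    (X Y : submodClosed P) :
  projective P -> sum_set [set` X] [set` Y] = setT ->
  exists f : {linear P -> P}, forall v, f v \in X /\ v - f v \in Y.
Proof.
move=> projP /sum_setTP XY.
have [|g gE] := @linear_of _ (submod X * submod Y)%type P
  (fun u => \val u.1 + \val u.2).
  by move=> a u v /=; rewrite scalerDr addrACA.
have [v|h hP] := projP _ _ g idfun.
  have [x [y [xX yY ->]]] := XY v.
  by exists (Submod xX, Submod yY); rewrite gE.
have [|f fE] := @linear_of _ P P (fun v => \val (h v).1).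
  by move=> a x y; rewrite linearP.
exists f => v; rewrite fE; split; first exact: valP.
by have := hP v; rewrite gE /= => {1}<-; rewrite addrC addKr; apply: valP.
Qed.

(** * Products of an ideal with a submodule *)

Lemma ideal_mul_linear (R : pzRingType) (I : zmodClosed R) (M N : lmodType R)
    (f : {linear M -> N}) (A : set M) (B : set N) x :
  (forall y, A y -> B (f y)) -> ideal_mul I A x -> ideal_mul I B (f x).
Proof.
move=> AB [n [a [y [aI yA ->]]]]; exists n, a, (f \o y).
split=> // [i|]; first exact: AB.
by rewrite linear_sum; apply: eq_bigr => i _; rewrite linearZ.
Qed.

Lemma ideal_mulS (R : pzRingType) (I : zmodClosed R) (M : lmodType R)
    (A B : set M) : A `<=` B -> ideal_mul I A `<=` ideal_mul I B.
Proof. by move=> AB x; apply: (ideal_mul_linear (f := idfun)) => y /AB. Qed.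

(** The projection onto [C] along [A] fixes [x] in [C] and kills [a], so [x] is the image of
    [x - a]; linearity carries [IM] into [IC]. *)
Lemma ideal_mul_summand (R : pzRingType) (I : zmodClosed R) (M : lmodType R)
    (A C X : submodClosed M) :
  direct_sum [set` A] [set` C] setT ->
  (forall x, x \in X -> exists2 a, a \in A & ideal_mul I setT (x - a)) ->
  [set` X] `&` [set` C] `<=` ideal_mul I [set` C].
Proof.
move=> /direct_sumC/direct_sum_proj[p [pC _ pK pA]] XA x [/= xX xC].
have [a aA xa] := XA x xX.
rewrite -[x]pK // -[x](subrK a) linearD (pA a) // addr0.
by apply: (ideal_mul_linear _ xa) => y _; apply: pC.
Qed.

Lemma ideal_mul_trace (R : pzRingType) (I : zmodClosed R) (M : lmodType R)
    (X C : submodClosed M) :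
  [set` X] `&` [set` C] `<=` ideal_mul I [set` C] ->
  trace_on X C `<=` ideal_mul I [set: submod C].
Proof.
move=> XC x xX; have [|n [a [y [aI yC xE]]]] := XC (\val x).
  by split=> //; apply: valP.
exists n, a, (fun i => Submod (yC i)); split=> //.
by apply: val_inj; rewrite xE raddf_sum.
Qed.

(** * PSD submodules *)

Lemma PSD_for_trace (R : pzRingType) (I : zmodClosed R) (M : lmodType R)
    (X C : submodClosed M) :
  PSD_for (submod C) I -> [set` X] `&` [set` C] `<=` ideal_mul I [set` C] ->
  PSD_in (trace_on X C).
Proof.
move=> psd /ideal_mul_trace XC.
have [i iE] := submod_inclusion C; have [N NE] := submod_preim i X.
have -> : trace_on X C = [set` N].
  by apply/seteqP; split=> x /=; rewrite NE iE.
by apply: psd => x /NE; rewrite iE => /XC.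
Qed.

(** Restates the PSD property inside [Y] through elements of [M], with [T] as the submodule to be
    complemented, so that later steps avoid the subtype [submod Y]. *)
Lemma PSD_in_trace_split (R : pzRingType) (M : lmodType R)
    (X Y T : submodClosed M) :
  PSD_in (trace_on X Y) -> (forall x, x \in T -> x \in Y) ->
  (forall y, y \in Y -> exists2 t, t \in T & y - t \in X) ->
  exists S : submodClosed M,
    [/\ forall s, s \in S -> s \in X /\ s \in Y,
        forall y, y \in Y -> exists2 t, t \in T & y - t \in S &
        forall s, s \in S -> s \in T -> s = 0].
Proof.
move=> psd TY XT.
have [i iE] := submod_inclusion Y; have [T' T'E] := submod_preim i T.
have [|S' [_ _ S'X /direct_sumTP[ST ST0]]] := psd T'.
  apply/sum_setTP => y; have [t tT ytX] := XT _ (valP y).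
  exists (y - Submod (TY t tT)), (Submod (TY t tT)).
  by split; rewrite ?subrK //=; apply/T'E; rewrite iE.
have [S SE] := submod_image i S'; exists S; split.
- by move=> _ /SE[s sS <-]; rewrite iE; split; [exact: S'X | exact: valP].
- move=> y yY; have [s [t [sS /T'E tT yE]]] := ST (Submod yY).
  exists (i t) => //; apply/SE; exists s => //.
  by rewrite -(addrK t s) -yE linearB [i (Submod _)]iE.
- move=> _ /SE[s sS <-] sT; rewrite (ST0 s) ?linear0 //; exact/T'E.
Qed.

(** The preimage [Z'] of [Z] contains the kernel of [f]. A complement [S] of [Z'] therefore meets
    the kernel trivially, so [f] maps [S] isomorphically onto a complement of [Z], which is again
    projective. *)
Lemma PSD_in_image (R : pzRingType) (W V : lmodType R) (f : {linear W -> V})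
    (N : set W) :
  (forall y, exists x, f x = y) -> PSD_in N -> PSD_in (f @` N).
Proof.
move=> f_surj psd Z /sum_setTP NZ.
have [Z' Z'E] := submod_preim f Z.
have [|S [projS _ SN /direct_sumTP[SZ SZ0]]] := psd Z'.
  apply/sum_setTP => x; have [_ [z [[n Nn <-] zZ xE]]] := NZ (f x).
  exists n, (x - n); split=> //; last by rewrite addrC subrK.
  by apply/Z'E; rewrite linearB xE addrC addKr.
have [fS fSE] := submod_image f S.
have dS : direct_sum [set` fS] [set` Z] setT.
  apply/direct_sumTP; split=> [y|_ /fSE[s sS <-] sZ].
    have [x <-] := f_surj y; have [s [z [sS /Z'E zZ ->]]] := SZ x.
    by exists (f s), (f z); split=> //; [apply/fSE; exists s|rewrite linearD].
  by rewrite (SZ0 s) ?linear0 //; apply/Z'E.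
exists fS; split=> //; last first.
- by move=> _ /fSE[s sS <-]; exists s => //; apply: SN.
- by exists Z.
have [i iE] := submod_inclusion S.
have [x|g gE] := @submod_corestrict _ _ _ fS (f \o i).
  by apply/fSE; exists (\val x); rewrite /= ?iE //; apply: valP.
apply: (projective_bijective (f := g)) projS => [y|x gx0].
  have /fSE[s sS sy] := valP y; exists (Submod sS); apply: val_inj.
  by rewrite gE /= iE.
apply: val_inj; apply: SZ0; first exact: valP.
by apply/Z'E; rewrite -iE -[f _]gE gx0 rpred0.
Qed.

(** * Decomposition of a supplemented projective module *)

Lemma supplemented_decomposition (R : pzRingType) (I : zmodClosed R)
    (P : lmodType R) (X : submodClosed P) :
  projective P -> supplemented I P ->
  exists A C : submodClosed P,
    [/\ direct_sum [set` A] [set` C] setT, [set` A] `<=` [set` X] &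
        [set` X] `&` [set` C] `<=` ideal_mul I [set` C]].
Proof.
move=> projP suppP.
have [Y [XY XYI psdXY]] := suppP X; have [W [YW _ psdYW]] := suppP Y.
have [f fP] := projective_split projP XY.
have [t tP] : exists t : {linear P -> P}, forall v, t v \in W /\ v - t v \in Y.
  apply: projective_split => //; apply/sum_setTP => v.
  have /sum_setTP/(_ v)[y [w [yY wW ->]]] := YW.
  by exists w, y; rewrite addrC.
have fX v := (fP v).1; have fY v := (fP v).2.
have tW v := (tP v).1; have tY v := (tP v).2.
pose g : {linear P -> P} := f \o t.
have gX v : g v \in X by exact: fX.
pose h : {linear P -> P} := idfun \- g.
have hE v : h v = v - g v by [].
have hY v : h v \in Y.
  (* Here [v - g v] is the sum of [v - t v] and [t v - f (t v)], both in [Y]. *)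
  by rewrite hE -(subrKA (t v)) rpredD.
have vE v : v = g v + h v by rewrite hE addrC subrK.
(* [U] is chosen to contain every [s] in [W] with [f s] fixed by [g] (take [w = s]); a complement of
   [U] in [W] then has no such [s] except 0. *)
have [U UE] : exists U : submodClosed P, forall u,
    u \in U <-> u \in W /\ exists2 w, w \in W & f u = g (f w).
  apply: submod_of => [|a u u' [uW [w wW fu]] [uW' [w' wW' fu']]].
    by split; [|exists 0]; rewrite ?rpred0 ?linear0.
  split; first by rewrite rpredD ?rpredZ.
  by exists (a *: w + w'); rewrite ?rpredD ?rpredZ // !linearP fu fu'.
have [||S0 [S0Y S0W S0U]] := PSD_in_trace_split (T := U) psdYW.
- by move=> u /UE[].
(* The difference [w - t (f w)] is the sum of [w - f w] and [f w - t (f w)], both in [Y]. *)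
- move=> w wW; exists (t (f w)); first by apply/UE; split=> //; exists w.
  by rewrite -(subrKA (f w)) rpredD.
have [S1 S1E] := submod_image f S0.
have S1XY s : s \in S1 -> s \in X /\ s \in Y.
  move=> /S1E[r /S0Y[rY _] <-]; split=> //.
  by rewrite -[f r](subKr r) submodB.
have [V VE] := submod_preim g S1.
(* If [h v = 0] then [v = g v = f s] with [s] in [S0], so [f s = g (f s)]; thus [s] lies in [U] and
   vanishes. *)
have V0 v : v \in V -> h v = 0 -> v = 0.
  move=> /VE/S1E[s sS sv] hv0.
  have {}sv : f s = v by rewrite sv [RHS]vE hv0 addr0.
  rewrite -sv (S0U s) ?linear0 //; apply/UE; have [_ sW] := S0Y s sS.
  by split=> //; exists s => //; rewrite sv [LHS]vE hv0 addr0.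
have [T TE] := submod_image h V.
have [||S2 [S2XY S2Y S2T]] := PSD_in_trace_split (T := T) psdXY.
- by move=> _ /TE[v _ <-].
(* Since [f u = g (f w)], the vector [y - f w] has [g]-value [f (t y - u)], hence lies in [V]; [y]
   differs from its [h]-value by [f w + g (y - f w)], an element of [X]. *)
- move=> y yY; have [u /UE[uW [w wW fu]] uS] := S0W (t y) (tW y).
  have gv : g (y - f w) \in S1.
    by apply/S1E; exists (t y - u) => //; rewrite !linearB /= fu.
  exists (h (y - f w)); first by apply/TE; exists (y - f w) => //; apply/VE.
  by rewrite hE !opprB addrCA [y + (_ - y)]addrC subrK rpredD ?gX.
have [A AE] := submod_preim h S2.
have AV v : exists2 w, w \in V & v - w \in A.
  have [_ /TE[w wV <-] vwS] := S2Y _ (hY v).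
  by exists w => //; apply/AE; rewrite linearB.
have dAV : direct_sum [set` A] [set` V] setT.
  apply/direct_sumTP; split=> [v|v /AE hv vV].
    by have [w wV vwA] := AV v; exists (v - w), w; rewrite subrK.
  by apply: V0 => //; apply: S2T => //; apply/TE; exists v.
exists A, V; split=> //.
  by move=> v /AE/S2XY[hvX _] /=; rewrite [v]vE rpredD ?gX.
(* It remains to place [w] in [X] and [Y]: [g w] is in [S1], and [h w = h x - h (x - w)] is in [X]
   because [h x = x - g x] and [h (x - w)] is in [S2]. *)
apply: (ideal_mul_summand dAV) => x xX; have [w wV xwA] := AV x.
exists (x - w) => //; rewrite opprB addrCA addrN addr0.
apply: (ideal_mulS (A := [set` Y])) => //; apply: XYI.
have /VE/S1XY[gwX gwY] := wV; split=> /=; rewrite [w]vE rpredD //.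
have /AE/S2XY[hX _] := xwA.
by rewrite -(subKr (h x) (h w)) -linearB submodB // hE submodB ?gX.
Qed.

(** * Free modules and free covers *)

Lemma sum_collect (R : pzRingType) (T : eqType) (N : lmodType R)
    (l : seq (R * T)) (G : T -> N) :
  \sum_(u <- l) u.1 *: G u.2 =
  \sum_(e <- undup (map snd l)) (\sum_(u <- l | u.2 == e) u.1) *: G e.
Proof.
under [RHS]eq_bigr do rewrite scaler_suml.
rewrite (exchange_big_dep xpredT) //= big_seq [RHS]big_seq.
apply: eq_bigr => u ul.
rewrite big_mkcond (bigD1_seq u.2) ?undup_uniq ?mem_undup ?map_f //= eqxx.
by rewrite big1 ?addr0 // => e; rewrite eq_sym => /negPf ->.
Qed.

(** [G] relates two values of one formal combination, with repetitions allowed so that concatenation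
    gives closure. Over 0, [sum_collect] merges the repetitions and independence makes every
    collected coefficient vanish. *)
Lemma basis_extension (R : pzRingType) (M N : lmodType R) (E : set M)
    (phi : M -> N) :
  is_basis E -> exists f : {linear M -> N}, forall e, E e -> f e = phi e.
Proof.
move=> [Efree Espan].
pose G x y := exists l : seq (R * M),
  [/\ forall u, u \in l -> E u.2, x = \sum_(u <- l) u.1 *: u.2 &
      y = \sum_(u <- l) u.1 *: phi u.2].
have GE e : E e -> G e (phi e).
  move=> Ee; exists [:: (1, e)]; rewrite !big_seq1 !scale1r; split=> // u.
  by rewrite inE => /eqP ->.
have GD a x y x' y' : G x y -> G x' y' -> G (a *: x + x') (a *: y + y').
  move=> [l [lE -> ->]] [l' [lE' -> ->]].
  exists ([seq (a * u.1, u.2) | u <- l] ++ l'); split.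
  - by move=> u; rewrite mem_cat => /orP[/mapP[v /lE vE ->]|/lE'].
  - rewrite big_cat big_map scaler_sumr; congr (_ + _).
    by apply: eq_bigr => u _; rewrite scalerA.
  - rewrite big_cat big_map scaler_sumr; congr (_ + _).
    by apply: eq_bigr => u _; rewrite scalerA.
have G0 y : G 0 y -> y = 0.
  move=> [l [lE /esym l0 ->]]; rewrite sum_collect big_seq big1 // => e el.
  rewrite (Efree _ (fun e' => \sum_(u <- l | u.2 == e') u.1) _ _ _ e el);
    rewrite ?scale0r ?undup_uniq //.
    by move=> e'; rewrite /= mem_undup => /mapP[u ul ->]; apply: lE.
  by rewrite -(sum_collect l id).
have [x||//|f fG] := linear_graph (G := G); last 1 first.
- exists f => e Ee; apply/esym/eqP; rewrite -subr_eq0; apply/eqP/G0.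
  have := GD (-1) _ _ _ _ (fG e) (GE e Ee).
  by rewrite !scaleN1r addNr addrC.
- have [s [c [sE ->]]] := Espan x.
  exists (\sum_(e <- s) c e *: phi e), [seq (c e, e) | e <- s].
  by rewrite !big_map; split=> // _ /mapP[e es ->]; apply: sE.
- exact: GD.
Qed.

Lemma free_projective (R : pzRingType) (P : lmodType R) :
  free_module P -> projective P.
Proof.
move=> [E basisE] M N g f g_surj.
have [phi phiP] := choice (fun e => g_surj (f e)).
have [h hE] := basis_extension phi basisE; exists h => p.
have [s [c [sE ->]]] := basisE.2 p.
rewrite !linear_sum big_seq [RHS]big_seq; apply: eq_bigr => e es.
by rewrite !linearZ /= hE ?phiP //; apply: sE.
Qed.

(* Over the zero ring F = 0, so d need not be injective; hence the hypothesis
   1 <> 0. *)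
Lemma free_on (R : pzRingType) (T : choiceType) (x0 : T) :
  exists (F : lmodType R) (d : T -> F) (w : F -> T),
    is_basis (range d) /\ ((1 : R) <> 0 -> cancel d w).
Proof.
(* [S] consists of the finitely supported functions, [d x] is the indicator of [x], and [w] recovers
   an index, with default [x0] off the range of [d]. *)
have [S SE] : exists S : submodClosed (T -> R^o), forall f,
    f \in S <-> exists s : seq T, forall x, x \notin s -> f x = 0.
  apply: submod_of => [|a f g [s sf] [s' sg]]; first by exists [::].
  exists (s ++ s') => x; rewrite mem_cat negb_or => /andP[/sf fx /sg gx].
  by rewrite -[LHS]/(a *: f x + g x) fx gx scaler0 addr0.
have dS x : (fun y => (y == x)%:R : R^o) \in S.
  by apply/SE; exists [:: x] => y; rewrite inE => /negPf ->.
pose d x : submod S := Submod (dS x).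
pose w e := xget x0 [set x | d x = e]; exists (submod S), d, w.
have sumE (I : Type) (s : seq I) (c : I -> R) (e : I -> submod S) y :
    \val (\sum_(i <- s) c i *: e i) y = \sum_(i <- s) c i * \val (e i) y.
  by rewrite raddf_sum fct_sumE.
have dK : (1 : R) <> 0 -> cancel d w.
  move=> R10 x; have : d (w (d x)) = d x.
    by apply: (@xgetPex _ x0 [set y | d y = d x]); exists x.
  move=> /(congr1 (fun e => \val e x))/=; rewrite eqxx.
  by case: eqP => // _ /esym/R10.
split=> //; split=> [s c us sd s0 e es|f].
  have [x _ xE] := sd e es; rewrite -{e}xE in es *.
  have := congr1 (fun e => \val e x) s0.
  rewrite sumE (bigD1_seq (d x)) //= eqxx mulr1.
  rewrite big_seq_cond big1 ?addr0 // => _ /andP[/sd[y _ <-] ne] /=.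
  by have [xy|] := eqVneq x y; [rewrite xy eqxx in ne | rewrite mulr0].
have [R10|/eqP/dK {}dK] := eqVneq (1 : R) 0.
  exists [::], (fun=> 0); split=> //.
  by rewrite big_nil -[f]scale1r R10 scale0r.
have /SE[s sf] := valP f.
exists (map d (undup s)), (fun e => \val f (w e)).
split=> [_ /mapP[x _ ->]|]; first by exists x.
apply: val_inj; apply/funext => y; rewrite big_map sumE.
under eq_bigr do rewrite dK.
have [ys|ys] := boolP (y \in s).
  rewrite (bigD1_seq y) ?undup_uniq ?mem_undup //= eqxx mulr1.
  by rewrite big1 ?addr0 // => x /negPf; rewrite eq_sym => ->; rewrite mulr0.
rewrite sf // big_seq big1 // => x /=; rewrite mem_undup.
by have [<- /(negP ys)|_ _] := eqVneq y x; rewrite ?mulr0.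
Qed.

Lemma free_cover (R : pzRingType) (M : lmodType R) :
  exists (F : lmodType R) (p : {linear F -> M}),
    free_module F /\ forall y, exists x, p x = y.
Proof.
(* The basis is indexed by [M] itself, and [p] sends each basis vector to its index. *)
have [F [d [w [basis_d dK]]]] := free_on R (0 : M).
have [p pP] := basis_extension w basis_d.
exists F, p; split=> [|x]; first by exists (range d).
have [R10|/eqP/dK {}dK] := eqVneq (1 : R) 0.
  by exists 0; rewrite -[p 0]scale1r -[x]scale1r R10 !scale0r.
by exists (d x); rewrite pP.
Qed.

(** * The implications between the conditions *)

Lemma lifting_supplemented (R : pzRingType) (I : zmodClosed R)
    (M : lmodType R) : lifting I M -> supplemented I M.
Proof.
move=> liftM X; have [A [B [/direct_sumTP[AB _] AX XBI psdB]]] := liftM X.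
exists B; split=> //; apply/sum_setTP => x.
by have [a [b [aA bB ->]]] := AB x; exists a, b; split=> //; apply: AX.
Qed.

Lemma supplemented_lifting (R : pzRingType) (I : zmodClosed R)
    (P : lmodType R) :
  strongly_left_PSD I -> projective P -> supplemented I P -> lifting I P.
Proof.
move=> psdR projP suppP X.
have [A [C [AC AX XCI]]] := supplemented_decomposition X projP suppP.
exists A, C; split=> //; apply: PSD_for_trace XCI; apply: psdR.
exact: projective_summand (direct_sumC AC) projP.
Qed.

(** A section [i] embeds [P] in a free module [F]. The copy [Xi] of [X] is decomposed in [F] and the
    pieces are pushed back by [p], which is inverse to [i] on [Xi]. *)
Lemma free_supplemented_left_perfect (R : pzRingType) (I : zmodClosed R) :
  (forall M : lmodType R, free_module M -> supplemented I M) -> left_perfect I.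
Proof.
move=> suppR P projP X; have [F [p [freeF p_surj]]] := free_cover P.
have [i ip] := projP _ _ p idfun p_surj; have {}ip x : p (i x) = x by exact: ip.
have [Xi XiE] := submod_image i X.
have [A [C [AC AX XCI]]] :=
  supplemented_decomposition Xi (free_projective freeF) (suppR F freeF).
have /direct_sumTP[AC1 AC0] := AC.
have [D DE] := submod_cap Xi C; have [C' C'E] := submod_preim i C.
have [pA pAE] := submod_image p A; have [pD pDE] := submod_image p D.
have pXi u : u \in Xi -> i (p u) = u by move=> /XiE[x _ <-]; rewrite ip.
exists pA, pD; split.
- split; apply/seteqP; split=> x.
  + move=> [_ /pAE[a /AX/XiE[y yX <-] <-]].
    move=> [_ /pDE[b /DE[/XiE[z zX <-] _] <-] <-].
    by rewrite /= !ip rpredD.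
  + move=> xX; have ixXi : i x \in Xi by apply/XiE; exists x.
    have [a [c [aA cC ixE]]] := AC1 (i x).
    exists (p a); first by apply/pAE; exists a.
    exists (p c); last by rewrite -linearD -ixE ip.
    apply/pDE; exists c => //; apply/DE; split=> //.
    by rewrite -(addKr a c) addrC -ixE submodB //; apply: AX.
  + move=> [/pAE[a aA ax] /pDE[b /DE[bXi bC] bx]]; rewrite /= -ax.
    rewrite (AC0 a) ?linear0 //.
    by rewrite -(pXi a) ?ax -?bx ?pXi //; apply: AX.
  + by move=> ->; split; apply: rpred0.
(* The complement of [pA] is the preimage of [C] under [i]: if [i x = a + c], then
   [i (x - p a) = c], as [i (p a) = a]. *)
- exists C'; apply/direct_sumTP; split=> [x|_ /pAE[a aA <-] /C'E].
    have [a [c [aA cC ixE]]] := AC1 (i x).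
    exists (p a), (x - p a); split; last by rewrite addrC subrK.
      by apply/pAE; exists a.
    apply/C'E; rewrite linearB ixE pXi; last exact: AX.
    by rewrite addrC addKr.
  by rewrite pXi => [aC|]; [rewrite (AC0 a) ?linear0|apply: AX].
- move=> _ /pDE[u /DE[uXi uC] <-].
  by apply: (ideal_mul_linear (A := [set` C])) => //; apply: XCI.
Qed.

Lemma left_perfect_supplemented (R : pzRingType) (I : zmodClosed R)
    (M : lmodType R) :
  strongly_left_PSD I -> left_perfect I -> supplemented I M.
Proof.
move=> psdR perfR X; have [F [p [freeF p_surj]]] := free_cover M.
have projF := free_projective freeF; have [Xp XpE] := submod_preim p X.
have [A [B [[ABX _] [C AC] BI]]] := perfR F projF Xp.
have AX a : a \in A -> p a \in X.
  move=> aA; apply/XpE; suff: [set` Xp] a by [].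
  by rewrite -ABX; exists a => //; exists 0; rewrite /= ?rpred0 ?addr0.
(* [B] complements [A] only within [Xp], while [C] does so in [F]; projecting [B] to [C] moves the
   inclusion in [IF] to one in [IC]. *)
have XCI : [set` Xp] `&` [set` C] `<=` ideal_mul I [set` C].
  apply: (ideal_mul_summand AC) => x xX; have : [set` Xp] x by [].
  rewrite -ABX => -[a aA [b bB <-]]; exists a => //.
  by rewrite addrC addKr; apply: BI.
have psdC : PSD_in (trace_on Xp C).
  apply: PSD_for_trace XCI; apply: psdR.
  exact: projective_summand (direct_sumC AC) projF.
have [Y YE] := submod_image p C; exists Y; split.
- apply/sum_setTP => y; have [x <-] := p_surj y.
  have /direct_sumTP[/(_ x)[a [c [aA cC ->]]] _] := AC.
  exists (p a), (p c); rewrite linearD; split=> //; first exact: AX.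
  by apply/YE; exists c.
- move=> x [/= + /YE[c cC cE]]; rewrite -{x}cE => pcX.
  apply: (ideal_mul_linear (A := [set` C])) => [y yC|].
    by apply/YE; exists y.
  by apply: XCI; split=> //; apply/XpE.
- have [i iE] := submod_inclusion C.
  have [c|f fE] := @submod_corestrict _ _ _ Y (p \o i).
    by apply/YE; exists (i c) => //; rewrite iE; apply: valP.
  have f_surj y : exists c, f c = y.
    have /YE[c cC cE] := valP y; exists (Submod cC); apply: val_inj.
    by rewrite fE /= iE.
  (* Since [Xp] is the full preimage of [X], any [c] in [C] mapped into [X] lies in [Xp]. *)
  have -> : trace_on X Y = f @` trace_on Xp C; last exact: PSD_in_image.
  apply/seteqP; split=> [y yX|_ [c cX <-]].
    have [c cE] := f_surj y; exists c => //; apply/XpE.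
    by rewrite -iE -[p _]fE cE.
  by rewrite /trace_on /= fE /= iE; apply/XpE.
Qed.

Theorem theorem3p14 (R : pzRingType) (I : zmodClosed R) (hI : two_sided I) :
  let c1 := forall M : lmodType R, supplemented I M in
  let c2 := forall M : lmodType R, projective M -> supplemented I M in
  let c3 := forall M : lmodType R, projective M -> lifting I M in
  let c4 := forall M : lmodType R, free_module M -> lifting I M in
  let c5 := forall M : lmodType R, free_module M -> supplemented I M in
  let c6 := left_perfect I in
  ((c1 -> c2) /\ (c2 -> c5) /\ (c5 -> c6) /\ (c3 -> c4) /\ (c4 -> c5)) /\
  (strongly_left_PSD I -> (c2 -> c3) /\ (c6 -> c1)).
Proof.
move=> c1 c2 c3 c4 c5 c6; split=> [|psdR]; first split.
- by move=> H M _; apply: H.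
- split; first by move=> H M /free_projective; apply: H.
  split; first exact: free_supplemented_left_perfect.
  split; first by move=> H M /free_projective; apply: H.
  by move=> H M /H; apply: lifting_supplemented.
- split; first by move=> H M projM; apply: supplemented_lifting (H M projM).
  by move=> H M; apply: left_perfect_supplemented.
Qed.
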